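(* Let $\mathsf{M}=(\mathfrak{D},\preceq,\bot,\top)$ be a system model and let $R\subseteq\mathfrak{D}$ be a prohibition. Then $R$ is $\mathbf{T}_r^{\mathsf{M}}$-refutable, where $\mathbf{T}_r^{\mathsf{M}}=(\mathfrak{D},\lfloor\cdot\rfloor)$ is the reflexive test setup of $\mathsf{M}$.
   Context: A system model is a tuple $(\mathfrak{D},\preceq,\bot,\top)$ where $\mathfrak{D}$ is a nonempty set (of systems), $\preceq$ is a partial order on $\mathfrak{D}$ (refinement), $\bot$ is the least element and $\top$ the greatest element. A requirement is a subset $R\subseteq\mathfrak{D}$. A requirement $R$ is a prohibition if it is refinement-closed: for all $S,S'\in\mathfrak{D}$, $S\in R$ and $S'\preceq S$ imply $S'\in R$. A test setup is a pair $\mathbf{T}=(T,\alpha)$ where $T$ is a set (of observations) and $\alpha:\mathfrak{D}\to 2^T$ is order-preserving: $S\preceq S'$ implies $\alpha(S)\subseteq\alpha(S')$. For $t\in T$, $\hat\alpha(t)=\{S\in\mathfrak{D}\mid t\in\alpha(S)\}$. A requirement $R$ is $\mathbf{T}$-refutable if for every $S\in\mathfrak{D}$ with $S\notin R$ there exists $t\in\alpha(S)$ with $\hat\alpha(t)\cap R=\emptyset$. The reflexive test setup of $\mathsf{M}$ is $\mathbf{T}_r^{\mathsf{M}}=(\mathfrak{D},\lfloor\cdot\rfloor)$, i.e. $T=\mathfrak{D}$ and $\alpha(S)=\lfloor S\rfloor=\{S'\in\mathfrak{D}\mid S'\preceq S\}$. *)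

(* Defs.v *)
From mathcomp Require Import all_boot all_order.
From mathcomp Require Import boolp classical_sets.
Set Implicit Arguments.
Unset Strict Implicit.
Unset Printing Implicit Defensive.

Import Order.TTheory.
Local Open Scope order_scope.
Local Open Scope classical_set_scope.

(* A system model is a [tbPOrderType]: a partial order (refinement) with a
   least and a greatest element, hence nonempty. Requirements are its
   subsets [R : set D]. *)

Definition prohibition d (D : tbPOrderType d) (R : set D) : Prop :=
  forall S S' : D, R S -> S' <= S -> R S'.

Record test_setup d (D : tbPOrderType d) := TestSetup {
  obs : Type;
  alpha : D -> set obs;
  alpha_homo : forall S S' : D, S <= S' -> alpha S `<=` alpha S'
}.

Arguments alpha {d D} _ _.

Definition alpha_hat d (D : tbPOrderType d) (T : test_setup D) (t : obs T) :
  set D := [set S | alpha T S t].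

Definition refutable d (D : tbPOrderType d) (T : test_setup D) (R : set D) :
  Prop :=
  forall S : D, ~ R S -> exists2 t : obs T, alpha T S t & alpha_hat t `&` R = set0.

Definition lower_closure d (D : tbPOrderType d) (S : D) : set D :=
  [set S' | S' <= S].

Lemma lower_closure_homo d (D : tbPOrderType d) (S S' : D) :
  S <= S' -> lower_closure S `<=` lower_closure S'.
Proof. by move=> leSS' S'' leS''S; exact: le_trans leS''S leSS'. Qed.

Definition reflexive_setup d (D : tbPOrderType d) : test_setup D :=
  TestSetup (@lower_closure_homo d D).

(* Main.v *)
Require Import Defs.
From mathcomp Require Import all_boot all_order.
From mathcomp Require Import boolp classical_sets.

Theorem lemma4 (d : Order.disp_t) (D : tbPOrderType d) (R : set D) :
  prohibition R -> refutable (reflexive_setup D) R.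
Proof.
(* Observations of the reflexive setup are systems, so the violating system [S] can serve as its own
   refuting observation; reflexivity puts it in its lower closure. *)
move=> closedR S nRS; exists S; first exact: Order.POrderTheory.le_refl.
(* [alpha_hat S] unfolds to the up-set of [S]: any [S'] in it is refined by [S], so [S'] in [R]
   would force [S] into [R] by refinement-closure. *)
rewrite -subset0 => S' [leSS' RS'].
exact: nRS (closedR _ _ RS' leSS').
Qed.
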